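(* There exists a universal constant $c>0$ such that the following holds. Let $P_0,P_1$ be Gaussian distributions on $\mathbb{R}^p$ with means $\mu_0,\mu_1$ and common covariance $C$, with $\mu_1-\mu_0$ in the range of $C$. Let $F_{10}=C^-(\mu_1-\mu_0)$, assumed nonzero, and $s_{10}=\frac{\mu_1+\mu_0}{2}$. Let $\hat F_{10},\hat s_{10}\in\mathbb{R}^p$ with $\|\hat F_{10}\|_{L_2(P_C)}\neq 0$, and let $g:\mathbb{R}^p\to\{0,1\}$ be the rule $g(x)=1$ if $\langle\hat F_{10},x-\hat s_{10}\rangle_{\mathbb{R}^p}\ge0$ and $g(x)=0$ otherwise. Define $$d_0=\frac{1}{\|\hat F_{10}\|_{L_2(P_C)}}\langle\hat F_{10},\hat s_{10}-s_{10}\rangle_{\mathbb{R}^p}$$ and let $\alpha=\alpha_{L_2(P_C)}(\hat F_{10},F_{10})$ be the angle between $\hat F_{10}$ and $F_{10}$ in $L_2(P_C)$. Then $$\frac12P\left(0<\mathcal{N}(0,1)\le\|F_{10}\|_{L_2(P_C)}\frac{1-\cos(\alpha)}{2}\right)e^{-\frac{\|F_{10}\|^2_{L_2(P_C)}}{8}}\le\mathcal{C}(g)-\mathcal{C}^*$$ and $$\mathcal{C}(g)-\mathcal{C}^*\le c\,P\left(|\mathcal{N}(0,1)|\le(1-\cos\alpha)\|F_{10}\|_{L_2(P_C)}\right)+c\,d_0^2.$$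
   Context: $C$ is a positive semi-definite $p\times p$ matrix and $C^-$ is its Moore–Penrose pseudo-inverse. For measurable $g:\mathbb{R}^p\to\{0,1\}$, $\mathcal{C}(g)=\frac12\left(P_1(g(X)\ne1)+P_0(g(X)\ne0)\right)$ is the misclassification probability under a uniform prior. $\mathcal{C}^*=\mathcal{C}(g^* )$, where $g^*(x)=1$ if $\langle F_{10},x-s_{10}\rangle_{\mathbb{R}^p}\ge0$ and $g^*(x)=0$ otherwise; $g^*$ is the Bayes rule, i.e. it minimizes $\mathcal{C}$. $P_C$ is the centered Gaussian measure on $\mathbb{R}^p$ with covariance $C$. For $u,v\in\mathbb{R}^p$, $\langle u,v\rangle_{L_2(P_C)}$ is the $L_2(P_C)$ scalar product of the linear forms $x\mapsto\langle u,x\rangle_{\mathbb{R}^p}$ and $x\mapsto\langle v,x\rangle_{\mathbb{R}^p}$, i.e. $\langle u,Cv\rangle_{\mathbb{R}^p}$; $\|\cdot\|_{L_2(P_C)}$ is the associated norm and $\alpha_{L_2(P_C)}(u,v)$ the associated angle, so that $\cos\alpha_{L_2(P_C)}(u,v)=\frac{\langle u,v\rangle_{L_2(P_C)}}{\|u\|_{L_2(P_C)}\|v\|_{L_2(P_C)}}$. $\mathcal{N}(0,1)$ denotes a standard real Gaussian random variable. *)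

(* Defs.v *)
From mathcomp Require Import all_boot all_order all_algebra.
From mathcomp Require Import all_classical all_reals all_analysis.
Import Order.TTheory GRing.Theory Num.Theory.
Import numFieldNormedType.Exports.

Set Implicit Arguments.
Unset Strict Implicit.
Unset Printing Implicit Defensive.

Local Open Scope classical_set_scope.
Local Open Scope ring_scope.

(* R^p, as column vectors with the Borel sigma-algebra; the carrier is
   convertible to 'cV[R]_p. *)
Definition borel_cV (R : realType) (p : nat) :=
  g_sigma_algebraType (@open 'cV[R]_p).

Definition dot (R : realType) (p : nat) (u v : 'cV[R]_p) : R :=
  (u^T *m v) 0 0.

Definition psd (R : realType) (p : nat) (C : 'M[R]_p) : Prop :=
  C^T = C /\ forall u : 'cV[R]_p, 0 <= dot u (C *m u).

Definition is_moore_penrose (R : realType) (p : nat) (C Cm : 'M[R]_p) : Prop :=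
  [/\ C *m Cm *m C = C,
      Cm *m C *m Cm = Cm,
      (C *m Cm)^T = C *m Cm
    & (Cm *m C)^T = Cm *m C].

(* The law N(m, s^2) on the line.  The degenerate case is handled apart because
   [normal_prob m 0] is not the Dirac mass at [m]. *)
Definition gauss1 (R : realType) (m s : R) : set (measurableTypeR R) -> \bar R :=
  if s == 0 then \d_m else normal_prob m s.

(* P is Gaussian with mean m and covariance C: every linear form <u, .> has law
   N(<u, m>, <u, C u>) under P.  C may be singular. *)
Definition is_gaussian (R : realType) (p : nat) (P : probability (borel_cV R p) R)
    (m : 'cV[R]_p) (C : 'M[R]_p) : Prop :=
  forall (u : 'cV[R]_p) (A : set (measurableTypeR R)), measurable A ->
    pushforward P (dot u : borel_cV R p -> measurableTypeR R) A =
    gauss1 (dot u m) (Num.sqrt (dot u (C *m u))) A.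

(* The L_2(P) scalar product of the linear forms <u, .> and <v, .>. *)
Definition L2dot (R : realType) (p : nat) (P : probability (borel_cV R p) R)
    (u v : 'cV[R]_p) : R :=
  \int[P]_x (dot u x * dot v x).

Definition L2norm (R : realType) (p : nat) (P : probability (borel_cV R p) R)
    (u : 'cV[R]_p) : R :=
  Num.sqrt (L2dot P u u).

Definition L2angle (R : realType) (p : nat) (P : probability (borel_cV R p) R)
    (u v : 'cV[R]_p) : R :=
  acos (L2dot P u v / (L2norm P u * L2norm P v)).

(* The classes 1 and 0 are encoded as [true] and [false]. *)
Definition linear_rule (R : realType) (p : nat) (F s : 'cV[R]_p)
    (x : borel_cV R p) : bool :=
  0 <= dot F (x - s : 'cV[R]_p).

Definition risk (R : realType) (p : nat) (P0 P1 : probability (borel_cV R p) R)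
    (g : borel_cV R p -> bool) : R :=
  2^-1 * (fine (P1 [set x | g x != true]) + fine (P0 [set x | g x != false])).

Definition stdnormal (R : realType) (A : set (measurableTypeR R)) : R :=
  fine (normal_prob 0 1 A).

(* Main.v *)
Require Import Defs.
From HB Require Import structures.
From mathcomp Require Import all_boot all_order all_algebra.
From mathcomp Require Import all_classical all_reals all_analysis.
From mathcomp Require Import measurable_realfun ring lra.
Import Order.TTheory GRing.Theory Num.Theory.
Import numFieldNormedType.Exports.

Local Open Scope classical_set_scope.
Local Open Scope ring_scope.

(* Write G and phi for the standard normal distribution function and density, and
   b = |F10| / 2, a = b cos alpha, where |.| is the L_2(P_C) norm. A half-space has
   probability G(t) under a Gaussian law, so C(g) = (G(-a + d0) + G(-a - d0)) / 2
   and C^* = G(-b). Since phi is even, decreasing in |x| and 1-Lipschitz,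
   G(-a + d) + G(-a - d) lies between min(2 G(-a), 1) and 2 G(-a) + d^2; it remains
   to compare G(b) - G(a) with the mass of intervals of length b - a based at the
   origin, and on [0, b - a] the density satisfies
   phi(a + t) >= phi(b) >= exp(-b^2/2) phi(t) when a >= 0.
   The constant c = 1 works. *)

(** * Distribution function of the normal law: derivative, affine change, symmetry *)

Definition cdfN {R : realType} (m s x : R) : R :=
  fine (normal_prob m s `]-oo, x]).

Lemma is_derive_cdfN {R : realType} (m s x : R) : s != 0 ->
  is_derive x 1 (cdfN m s) (normal_pdf m s x).
Proof.
move=> s0.
(* The fundamental theorem of calculus needs a half-line reaching past [x]; the endpoint [x + 1] is
   arbitrary. *)
have xx1 : x < x + 1 by rewrite ltrDl.
have ip : lebesgue_measure.-integrable [set` `]-oo, x + 1]] (EFin \o normal_pdf m s).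
  by apply: (integrableS measurableT) => //; exact: integrable_normal_pdf.
have [||dF F'] := continuous_FTC1 xx1 ip.
- exact: ltNyr.
- exact: continuous_normal_pdf.
by apply: DeriveDef => //; rewrite -derive1E.
Qed.

Lemma normal_pdf_shift {R : realType} (m s x : R) : 0 < s ->
  normal_pdf m s x = s^-1 * normal_pdf 0 1 ((x - m) / s).
Proof.
move=> s0; have s1 : s != 0 by rewrite gt_eqF.
rewrite !normal_pdfE ?oner_neq0// /normal_peak /normal_fun mulrA; congr (_ * expR _).
  rewrite -mulrnAr sqrtrM ?sqr_ge0// sqrtr_sqr gtr0_norm// expr1n mul1r.
  by rewrite invfM.
by field.
Qed.

Lemma is_derive_cdfN_comp {R : realType} (f : R -> R) (x df : R) :
  is_derive x 1 f df ->
  is_derive x 1 (fun y => cdfN 0 1 (f y)) (normal_pdf 0 1 (f x) * df).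
Proof.
move=> h; apply: is_derive1_comp; exact: is_derive_cdfN (oner_neq0 _).
Qed.

Lemma is_derive_affine {R : realType} (a b x : R) :
  is_derive x 1 (fun y => a * y + b) a.
Proof.
by apply: is_derive_eq; rewrite addr0 [LHS]mulr1.
Qed.

Lemma cvg_cdfN_Ny {R : realType} (m s : R) : cdfN m s x @[x --> -oo] --> 0.
Proof.
have mid : measurable_fun [set: measurableTypeR R]
  (idfun : measurableTypeR R -> R) by exact: measurable_id.
pose X : {RV (normal_prob m s) >-> R} :=
  HB.pack (idfun : measurableTypeR R -> R) (isMeasurableFun.Build _ _ _ _ _ mid).
have := cvg_cdfNy0 X.
move=> /fine_cvg; apply: cvg_trans.
exact: cvg_refl.
Qed.

Lemma cdfN_shift {R : realType} (m s x : R) : 0 < s ->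
  cdfN m s x = cdfN 0 1 ((x - m) / s).
Proof.
move=> s0; have s1 : s != 0 by rewrite gt_eqF.
(* Both sides have the same derivative and the same limit at -oo. *)
pose D y := cdfN m s y - cdfN 0 1 (s^-1 * y + (- m / s)).
have D' (y : R) : is_derive y 1 D 0.
  have h1 := is_derive_cdfN m s y s1.
  have h3 := is_derive_cdfN_comp _ _ _ (is_derive_affine s^-1 (- m / s) y).
  apply: is_derive_eq; rewrite (normal_pdf_shift m)//.
  have -> : (y - m) / s = s^-1 * y + - m / s by rewrite mulrDl mulrC.
  by rewrite mulrC subrr.
have Dx y : D y = D x by exact: is_derive_0_is_cst.
have D0 : D y @[y --> -oo] --> 0 - 0.
  apply: cvgB; first exact: cvg_cdfN_Ny.
  apply: (cvg_comp _ (cdfN 0 1) _ (cvg_cdfN_Ny 0 1)).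
  apply/cvgrNyPle => A.
  apply: filterS (nbhs_ninfty_le (num_real ((A - - m / s) * s))) => y /= yA.
  by rewrite -lerBrDr mulrC ler_pdivrMr.
have Dcst : D y @[y --> -oo] --> D x.
  by under eq_cvg do rewrite Dx; exact: cvg_cst.
have := cvg_unique (@Rhausdorff R) D0 Dcst; rewrite subrr => D0x.
apply: subr0_eq; rewrite [RHS]D0x /D.
by rewrite mulrDl (mulrC s^-1).
Qed.

Lemma normal_prob_Nyo {R : realType} (m s x : R) :
  fine (normal_prob m s `]-oo, x[) = cdfN m s x.
Proof.
rewrite /cdfN /normal_prob integral_itv_bndo_bndc//.
apply/measurable_EFinP; apply: measurable_funTS; exact: measurable_normal_pdf.
Qed.

Lemma normal_prob_cy {R : realType} (m s x : R) :
  fine (normal_prob m s `[x, +oo[) = 1 - cdfN m s x.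
Proof.
rewrite -setCitvl probability_setC//= fineB// ?fin_num_measure//.
by rewrite normal_prob_Nyo.
Qed.

Lemma normal_prob_oc {R : realType} (m s a b : R) : a <= b ->
  fine (normal_prob m s `]a, b]) = cdfN m s b - cdfN m s a.
Proof.
move=> ab; rewrite /cdfN; apply/eqP; rewrite eq_sym subr_eq addrC; apply/eqP.
rewrite -fineD ?fin_num_measure// -measureU//.
  by congr (fine (normal_prob m s _)); rewrite -itv_bndbnd_setU.
apply/seteqP; split => // t /= []; rewrite !in_itv/= => ta /andP[].
by rewrite ltNge ta.
Qed.

(** The density is even, so its total mass 1 is twice the mass of [[0, +oo[]. *)
Lemma cdfN0 {R : realType} : cdfN 0 1 0 = 2^-1 :> R.
Proof.
have e : forall x : R, normal_pdf 0 1 x = normal_pdf 0 1 (- x).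
  by move=> x; rewrite !normal_pdfE ?oner_neq0// /normal_fun !subr0 sqrrN.
have := @ge0_symfun_integralT R (normal_pdf 0 1) (normal_pdf_ge0 _ _)
  (@continuous_normal_pdf R 0 1 (oner_neq0 _)) e.
rewrite integral_normal_pdf -set_itvcy => /(congr1 fine).
rewrite -/(normal_prob 0 1 _) fineM ?fin_num_measure// normal_prob_cy /=.
move=> h; lra.
Qed.

Lemma cdfN01N {R : realType} (x : R) : cdfN 0 1 (- x) = 1 - cdfN 0 1 x.
Proof.
pose D (y : R) := cdfN 0 1 y + cdfN 0 1 (- y).
suff : D x = D 0 by rewrite /D oppr0 !cdfN0; lra.
apply: is_derive_0_is_cst => y.
have h1 := is_derive_cdfN 0 1 y (oner_neq0 _).
have h2 := is_derive_cdfN_comp _ _ _ (is_deriveN (is_derive_id y 1)).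
apply: is_derive_eq.
rewrite !normal_pdfE ?oner_neq0// /normal_fun !subr0 sqrrN. ring.
Qed.

(** * Monotonicity from derivatives, and estimates on the standard density *)

Lemma is_derive_ge0_le {R : realType} (f df : R -> R) (a b : R) : a <= b ->
  (forall x : R, is_derive x 1 f (df x)) ->
  (forall x, a <= x <= b -> 0 <= df x) -> f a <= f b.
Proof.
move=> ab h h0.
have cf : {within `[a, b], continuous f}.
  apply/continuous_subspaceT=> r.
  apply/differentiable_continuous/derivable1_diffP; exact: ex_derive.
have [c cab E] := MVT_segment ab (fun x _ => h x) cf.
by rewrite -subr_ge0 E mulr_ge0 ?subr_ge0//; apply: h0.
Qed.

Lemma stdpdfE {R : realType} (x : R) :
  normal_pdf 0 1 x = normal_peak 1 * expR (- (x ^+ 2 / 2)).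
Proof.
by rewrite normal_pdfE ?oner_neq0// /normal_fun subr0 expr1n mulNr.
Qed.

Lemma stdpdf_le {R : realType} (x y : R) : `|x| <= `|y| ->
  normal_pdf 0 1 y <= normal_pdf 0 1 x.
Proof.
move=> xy; rewrite !stdpdfE ler_wpM2l ?normal_peak_ge0// ler_expR lerN2.
by rewrite ler_wpM2r ?invr_ge0// -[x ^+ 2]real_normK ?num_real//
  -[y ^+ 2]real_normK ?num_real// ler_sqr ?nnegrE.
Qed.

Lemma is_derive_stdpdf {R : realType} (x : R) :
  is_derive x 1 (normal_pdf 0 1) (- (x * normal_pdf 0 1 x)).
Proof.
have -> : normal_pdf 0 1 = (fun y : R => normal_peak 1 * expR (- 2^-1 * y ^+ 2)).
  by apply/funext => y; rewrite stdpdfE mulNr [2^-1 * _]mulrC.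
have h1 : is_derive x 1 (fun y : R => - 2^-1 * y ^+ 2) (- x).
  by apply: is_derive_eq; rewrite /GRing.scale/=; field.
have h2 := @is_derive1_comp R expR (fun y : R => - 2^-1 * y ^+ 2) x _ _
  (is_derive_expR _) h1.
have h3 := is_deriveZ (normal_peak 1) h2.
by apply: is_derive_eq; rewrite /GRing.scale/=; ring.
Qed.

(** The peak is at most 1 since [pi >= 2], and [expR y >= 1 + y] bounds the inverse of the
    exponential. This rational bound serves both the slope of the density and its decay at
    infinity. *)
Lemma stdpdf_le_invD {R : realType} (x : R) :
  normal_pdf 0 1 x <= (1 + x ^+ 2 / 2)^-1.
Proof.
have p1 : normal_peak 1 <= 1 :> R.
  rewrite /normal_peak expr1n mul1r invf_le1.
    by rewrite -[leLHS]sqrtr1 ler_wsqrtr//; have := @pi_ge2 R; lra.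
  by rewrite sqrtr_gt0 mulrn_wgt0// pi_gt0.
have q0 : 0 < 1 + x ^+ 2 / 2 by rewrite ltr_pwDl// divr_ge0// sqr_ge0.
rewrite stdpdfE (@le_trans _ _ (expR (- (x ^+ 2 / 2))))//.
  by rewrite ler_piMl// expR_ge0.
by rewrite expRN lef_pV2 ?posrE ?expR_gt0// expR_ge1Dx.
Qed.

(** Since [phi' x = - x * phi x], this bounds the slope of the density by 1. For negative [x] it
    follows from [(x + 1) ^+ 2 >= 0]. *)
Lemma stdpdf_slope {R : realType} (x : R) : - 1 <= x * normal_pdf 0 1 x.
Proof.
have [x0|x0] := leP 0 x.
  by rewrite (@le_trans _ _ 0)// mulr_ge0// normal_pdf_ge0.
rewrite lerNl -mulNr.
have q0 : 0 < 1 + x ^+ 2 / 2 by rewrite ltr_pwDl// divr_ge0// sqr_ge0.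
apply: (@le_trans _ _ (- x * (1 + x ^+ 2 / 2)^-1)).
  by rewrite ler_wpM2l ?stdpdf_le_invD// oppr_ge0 ltW.
rewrite ler_pdivrMr// mul1r.
by have := sqr_ge0 (x + 1); rewrite sqrrD; lra.
Qed.

Lemma stdpdf_lipschitz {R : realType} (x y : R) : x <= y ->
  normal_pdf 0 1 y - normal_pdf 0 1 x <= y - x.
Proof.
move=> xy; suff : x - normal_pdf 0 1 x <= y - normal_pdf 0 1 y by lra.
apply: (@is_derive_ge0_le _ (fun t => t - normal_pdf 0 1 t)
  (fun t => 1 + t * normal_pdf 0 1 t)) => // t.
  have h := is_derive_stdpdf t.
  by apply: is_derive_eq; rewrite opprK.
by have := stdpdf_slope t; lra.
Qed.

(** * Bounds on the excess risk as a function of [a], [b] and the offset [d] *)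

Lemma is_derive_cdf_pair {R : realType} (a d : R) :
  is_derive d 1 (fun t => cdfN 0 1 (t - a) + cdfN 0 1 (- a - t))
    (normal_pdf 0 1 (d - a) - normal_pdf 0 1 (- a - d)).
Proof.
have h1 := is_derive_cdfN_comp _ _ _ (is_derive_affine 1 (- a) d).
have h2 := is_derive_cdfN_comp _ _ _ (is_derive_affine (-1) (- a) d).
have -> : (fun t => cdfN 0 1 (t - a) + cdfN 0 1 (- a - t)) =
  (fun t => cdfN 0 1 (1 * t - a) + cdfN 0 1 (- 1 * t - a)).
  by apply/funext => t; rewrite mul1r mulN1r [- a - t]addrC.
by apply: is_derive_eq; rewrite mul1r mulN1r [- a - d]addrC mulr1 mulrN1.
Qed.

(** The derivative in [d] is [phi(d - a) - phi(- a - d)], nonnegative because [d - a] is no farther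
    from 0 than [- a - d]. *)
Lemma cdf_pair_ge {R : realType} (a d : R) : 0 <= a -> 0 <= d ->
  cdfN 0 1 (- a) *+ 2 <= cdfN 0 1 (d - a) + cdfN 0 1 (- a - d).
Proof.
move=> a0 d0.
have := is_derive_ge0_le _ _ _ _ d0 (is_derive_cdf_pair a).
rewrite sub0r subr0 mulr2n; apply => t /andP[t0 _].
rewrite subr_ge0 stdpdf_le// ler_norml; apply/andP; split.
  by rewrite -opprD normrN ger0_norm ?addr_ge0//; lra.
by rewrite -opprD normrN ger0_norm ?addr_ge0//; lra.
Qed.

(** The two arguments in the derivative lie [2 * d] apart and the density has slope at most 1, so
    the derivative is at most that of [d ^+ 2]. *)
Lemma cdf_pair_le {R : realType} (a d : R) : 0 <= d ->
  cdfN 0 1 (d - a) + cdfN 0 1 (- a - d) <= cdfN 0 1 (- a) *+ 2 + d ^+ 2.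
Proof.
move=> d0.
pose f (t : R) := t ^+ 2 - (cdfN 0 1 (t - a) + cdfN 0 1 (- a - t)).
suff : f 0 <= f d by rewrite /f sub0r subr0 expr0n/= mulr2n; lra.
pose df t := 2 * t - (normal_pdf 0 1 (t - a) - normal_pdf 0 1 (- a - t)).
apply: (is_derive_ge0_le f df) => // t.
  have h := is_derive_cdf_pair a t.
  by apply: is_derive_eq; rewrite /df /GRing.scale/=; ring.
move=> /andP[t0 _]; rewrite /df.
have : - a - t <= t - a by lra.
by move=> /stdpdf_lipschitz; lra.
Qed.

Lemma cdfN_le {R : realType} (x y : R) : x <= y -> cdfN 0 1 x <= cdfN 0 1 y.
Proof.
move=> xy; apply: (is_derive_ge0_le _ _ _ _ xy (fun z => is_derive_cdfN 0 1 z (oner_neq0 _))).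
by move=> z _; exact: normal_pdf_ge0.
Qed.

(** Concavity of [G] on the positive half-line, where the density decreases. *)
Lemma cdf_increment_le {R : realType} (x y l : R) : 0 <= x -> x <= y -> 0 <= l ->
  cdfN 0 1 (y + l) - cdfN 0 1 y <= cdfN 0 1 (x + l) - cdfN 0 1 x.
Proof.
move=> x0 xy l0.
pose f t := cdfN 0 1 (1 * t + x) - cdfN 0 1 (1 * t + y).
suff : f 0 <= f l by rewrite /f !mulr0 !mul1r !add0r ![l + _]addrC; lra.
apply: (is_derive_ge0_le f
  (fun t => normal_pdf 0 1 (1 * t + x) - normal_pdf 0 1 (1 * t + y))) => // t.
  have h1 := is_derive_cdfN_comp _ _ _ (is_derive_affine 1 x t).
  have h2 := is_derive_cdfN_comp _ _ _ (is_derive_affine 1 y t).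
  by apply: is_derive_eq; rewrite !mulr1.
move=> /andP[t0 _]; rewrite mul1r subr_ge0 stdpdf_le// !ger0_norm; lra.
Qed.

Lemma cdf_increment_ge {R : realType} (a b : R) : 0 <= a -> a <= b ->
  (cdfN 0 1 (b - a) - 2^-1) * expR (- (b ^+ 2 / 2)) <= cdfN 0 1 b - cdfN 0 1 a.
Proof.
move=> a0 ab; set e := expR _.
pose f t := cdfN 0 1 (1 * t + a) - e * cdfN 0 1 t.
suff : f 0 <= f (b - a).
  by rewrite /f mulr0 add0r mul1r subrK cdfN0; lra.
apply: (is_derive_ge0_le _
    (fun t => normal_pdf 0 1 (1 * t + a) - e * normal_pdf 0 1 t)).
- by rewrite subr_ge0.
- move=> t; have h1 := is_derive_cdfN_comp _ _ _ (is_derive_affine 1 a t).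
  have h2 := is_derive_cdfN 0 1 t (oner_neq0 _).
  by apply: is_derive_eq; rewrite mulr1.
- move=> t /andP[t0 tba]; rewrite mul1r subr_ge0.
  (* The density at [b] separates the two sides: [e * phi(t) <= e * phi(0) = phi(b)], and
     [phi(b) <= phi(a + t)] as [a + t <= b]. *)
  apply: (@le_trans _ _ (normal_pdf 0 1 b)).
    rewrite !stdpdfE -/e mulrC ler_wpM2r ?expR_ge0// ler_piMr ?normal_peak_ge0//.
    by rewrite -expR0 ler_expR oppr_le0 divr_ge0 ?sqr_ge0.
  by apply: stdpdf_le; rewrite !ger0_norm; lra.
Qed.

(** For [a >= 0] the offset can only increase the risk, and the increment bound applies. For [a < 0]
    the risk is at least 1/2, so the excess is at least [G(b) - 1/2]. *)
Lemma excess_lower {R : realType} (a b d : R) : - b <= a -> a <= b ->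
  2^-1 * (cdfN 0 1 (b - a) - 2^-1) * expR (- (b ^+ 2 / 2)) <=
  2^-1 * (cdfN 0 1 (- a + d) + cdfN 0 1 (- a - d)) - cdfN 0 1 (- b).
Proof.
(* Changing the sign of [d] only swaps the two terms of the pair. *)
move=> ba ab; wlog d0 : d / 0 <= d.
  move=> H; have [|d0] := leP 0 d; first exact: H.
  by have := H (- d); rewrite opprK oppr_ge0 ltW// => /(_ isT); lra.
have b0 : 0 <= b by lra.
have G0 : 2^-1 <= cdfN 0 1 (b - a) by rewrite -cdfN0 cdfN_le// subr_ge0.
have [a0|a0] := leP 0 a.
  have := cdf_pair_ge a d a0 d0; have := cdf_increment_ge a b a0 ab.
  rewrite [- a + d]addrC !cdfN01N -mulrA; set E := _ * expR _.
  have : 0 <= E by rewrite mulr_ge0 ?expR_ge0// subr_ge0.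
  lra.
have e1 : expR (- (b ^+ 2 / 2)) <= 1.
  by rewrite -expR0 ler_expR oppr_le0 divr_ge0 ?sqr_ge0.
have : (cdfN 0 1 (b - a) - 2^-1) * expR (- (b ^+ 2 / 2)) <= cdfN 0 1 (b - a) - 2^-1.
  by rewrite ler_piMr// subr_ge0.
(* Concavity gives [G(2b) - 1/2 <= 2 (G(b) - 1/2)]; as [b - a <= 2b], the factor 1/2 of the claim
   absorbs the 2. *)
have := cdf_increment_le 0 b b (lexx _) b0 b0; rewrite add0r cdfN0.
have : cdfN 0 1 (b - a) <= cdfN 0 1 (b + b) by apply: cdfN_le; lra.
have : cdfN 0 1 (a + d) <= cdfN 0 1 (- a + d) by apply: cdfN_le; lra.
have -> : - a - d = - (a + d) by rewrite opprD.
rewrite !cdfN01N -mulrA.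
set E := _ * expR _.
lra.
Qed.

(** The pair bound leaves [G(b) - G(a)]. For [a >= 0] concavity moves the interval to the origin;
    for [a < 0] the symmetric interval of half-width [2 * (b - a)] contains [[a, b]]. *)
Lemma excess_upper {R : realType} (a b d : R) : - b <= a -> a <= b ->
  2^-1 * (cdfN 0 1 (- a + d) + cdfN 0 1 (- a - d)) - cdfN 0 1 (- b) <=
  (cdfN 0 1 (2 * (b - a)) - cdfN 0 1 (- (2 * (b - a)))) + d ^+ 2.
Proof.
move=> ba ab; wlog d0 : d / 0 <= d.
  move=> H; have [|d0] := leP 0 d; first exact: H.
  by have := H (- d); rewrite opprK sqrrN oppr_ge0 ltW// => /(_ isT); lra.
have b0 : 0 <= b by lra.
have := cdf_pair_le a d d0; rewrite [- a + d]addrC.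
suff : cdfN 0 1 b - cdfN 0 1 a <=
    cdfN 0 1 (2 * (b - a)) - cdfN 0 1 (- (2 * (b - a))).
  by have := sqr_ge0 d; rewrite (cdfN01N a) (cdfN01N b); lra.
have [a0|a0] := leP 0 a.
  have := cdf_increment_le 0 a (b - a) (lexx _) a0; rewrite subr_ge0 ab => /(_ isT).
  rewrite [a + _]addrC subrK add0r.
  have : cdfN 0 1 (b - a) <= cdfN 0 1 (2 * (b - a)) by apply: cdfN_le; lra.
  have : cdfN 0 1 (- (2 * (b - a))) <= cdfN 0 1 (0 : R) by apply: cdfN_le; lra.
  lra.
have : cdfN 0 1 b <= cdfN 0 1 (2 * (b - a)) by apply: cdfN_le; lra.
have : cdfN 0 1 (- (2 * (b - a))) <= cdfN 0 1 a by apply: cdfN_le; lra.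
lra.
Qed.

(** * Second moment of the standard normal law *)

(** The Radon-Nikodym derivative agrees almost everywhere with the density, both having the same
    integrals over measurable sets. *)
Lemma ge0_integral_normal_prob {R : realType} (m s : R) (f : R -> \bar R) :
  (forall x, (0 <= f x)%E) -> measurable_fun [set: R] f ->
  (\int[normal_prob m s]_x f x =
   \int[lebesgue_measure]_x (f x * (normal_pdf m s x)%:E))%E.
Proof.
move=> f0 mf.
have dom := normal_prob_dominates m s.
rewrite -(Radon_Nikodym_SigmaFinite.change_of_variables dom)//.
have mpdf : measurable_fun [set: R] (EFin \o normal_pdf m s).
  by apply/measurable_EFinP; exact: measurable_normal_pdf.
have mRN := measurable_int _ (Radon_Nikodym_SigmaFinite.f_integrable dom).
apply: ae_eq_integral => //.
- exact: emeasurable_funM.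
- exact: emeasurable_funM.
apply: ae_eqe_mul2l; apply: integral_ae_eq => //.
  exact: Radon_Nikodym_SigmaFinite.f_integrable.
by move=> E _ mE; rewrite -Radon_Nikodym_SigmaFinite.f_integral.
Qed.

Lemma cvg_cdfN_y {R : realType} : cdfN 0 1 x @[x --> +oo] --> (1 : R).
Proof.
have -> : cdfN 0 1 = (fun x : R => 1 - cdfN 0 1 (- x)).
  by apply/funext => x; rewrite cdfN01N opprB addrC subrK.
rewrite -[X in _ --> X]subr0; apply: cvgB; first exact: cvg_cst.
by have := @cvg_cdfN_Ny R 0 1; rewrite cvgNy_compNP.
Qed.

(** A polynomial decay that makes the boundary term of an integration by parts vanish at
    infinity. *)
Lemma stdpdf_tail {R : realType} (x : R) : 0 < x ->
  x * normal_pdf 0 1 x <= 2 / x.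
Proof.
move=> x0.
have q0 : 0 < 1 + x ^+ 2 / 2 by rewrite ltr_pwDl// divr_ge0// sqr_ge0.
apply: (@le_trans _ _ (x * (1 + x ^+ 2 / 2)^-1)).
  by rewrite ler_wpM2l ?stdpdf_le_invD// ltW.
by rewrite ler_pdivrMr// mulrAC ler_pdivlMr// -expr2; lra.
Qed.

Lemma cvg_x_stdpdf {R : realType} : x * normal_pdf 0 1 x @[x --> +oo] --> (0 : R).
Proof.
apply/cvgr0Pnorm_le => e e0.
apply: filterS (nbhs_pinfty_ge (num_real (3 / e))) => x /= xe.
have x0 : 0 < x by rewrite (lt_le_trans _ xe)// divr_gt0.
rewrite ger0_norm ?mulr_ge0 ?normal_pdf_ge0 ?ltW//.
apply: (le_lt_trans (stdpdf_tail _ x0)).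
move: xe; rewrite ltr_pdivrMr// ler_pdivrMr// mulrC; lra.
Qed.

Lemma stdnormal_second_moment {R : realType} :
  (\int[normal_prob 0 1]_x ((x ^+ 2)%:E : \bar R) = 1)%E.
Proof.
rewrite ge0_integral_normal_prob; last 2 first.
- by move=> x; rewrite lee_fin sqr_ge0.
- by apply/measurable_EFinP; exact: exprn_measurable.
pose f (x : R) := x ^+ 2 * normal_pdf 0 1 x.
have f0 x : 0 <= f x by rewrite mulr_ge0 ?sqr_ge0 ?normal_pdf_ge0.
have cf : continuous f.
  move=> x; apply: cvgM; first exact: exprn_continuous.
  exact: continuous_normal_pdf (oner_neq0 _) _.
under eq_integral do rewrite -EFinM -/(f _).
rewrite ge0_symfun_integralT//; last first.
  by move=> x; rewrite /f /= sqrrN !stdpdfE sqrrN.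
rewrite -set_itvcy.
(* Since [phi' x = - x * phi x], [G x - x * phi x] is a primitive of [x ^+ 2 * phi x]. *)
pose F (x : R) := cdfN 0 1 x - x * normal_pdf 0 1 x.
have dF (x : R) : is_derive x 1 F (f x).
  have h1 := is_derive_cdfN 0 1 x (oner_neq0 _).
  have h2 := is_derive_stdpdf x.
  by apply: is_derive_eq; rewrite /f /GRing.scale/=; ring.
rewrite (@ge0_continuous_FTC2y _ f F 0 1)//.
- by rewrite /F cdfN0 mul0r subr0 -EFinD -EFinM; congr EFin; field.
- exact: continuous_subspaceT.
- by rewrite -[X in _ --> X]subr0; apply: cvgB; [exact: cvg_cdfN_y|exact: cvg_x_stdpdf].
- apply: cvg_at_right_filter; apply/differentiable_continuous/derivable1_diffP.
  exact: ex_derive.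
- by move=> x _; rewrite derive1E derive_val.
Qed.

(** * Linear forms on vectors and the semi-definite form of [C] *)

Lemma measurable_dot {R : realType} (p : nat) (u : 'cV[R]_p) :
  measurable_fun [set: borel_cV R p] (dot u : borel_cV R p -> measurableTypeR R).
Proof.
have cu i : continuous (fun x : 'cV[R]_p => u i 0 * x i 0).
  move=> x; apply: (@cvgM R _ (nbhs x)); first exact: cvg_cst.
  exact: coord_continuous.
have cd : continuous (dot u : 'cV[R]_p -> R).
  have -> : dot u = (fun x : 'cV[R]_p => \sum_i u i 0 * x i 0).
    by apply/funext => x; rewrite /dot mxE; apply: eq_bigr => i _; rewrite mxE.
  apply: (@continuous_big R^o 'I_p +%R 0 xpredT _ 'cV[R]_p) => [|i _].
    move=> xy; apply: (@cvgD R R^o _ (nbhs xy)); [exact: cvg_fst|exact: cvg_snd].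
  exact: cu.
apply: (measurability _ (RGenOpens.measurableE R)) => // _ [_ [a [b ->] <-]].
rewrite setTI; apply: sub_sigma_algebra.
move/continuousP : cd; apply; exact: interval_open.
Qed.

Section dot.
Context {R : realType} {p : nat}.
Implicit Types (u v w : 'cV[R]_p) (C : 'M[R]_p).

Lemma dotC u v : dot u v = dot v u.
Proof. by rewrite /dot -[in LHS](trmxK v) -trmx_mul mxE. Qed.

Lemma dotDr u v w : dot u (v + w) = dot u v + dot u w.
Proof. by rewrite /dot mulmxDr mxE. Qed.

Lemma dotNr u v : dot u (- v) = - dot u v.
Proof. by rewrite /dot mulmxN mxE. Qed.

Lemma dotZr (k : R) u v : dot u (k *: v) = k * dot u v.
Proof. by rewrite /dot -scalemxAr mxE. Qed.

Lemma dotDl u v w : dot (u + v) w = dot u w + dot v w.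
Proof. by rewrite dotC dotDr !(dotC w). Qed.

Lemma dotNl u v : dot (- u) v = - dot u v.
Proof. by rewrite dotC dotNr dotC. Qed.

Lemma dotZl (k : R) u v : dot (k *: u) v = k * dot u v.
Proof. by rewrite dotC dotZr dotC. Qed.

Lemma dot_symm C u v : C^T = C -> dot u (C *m v) = dot v (C *m u).
Proof. by move=> CT; rewrite dotC /dot trmx_mul CT mulmxA. Qed.

Lemma psd_cauchy_schwarz C u v : psd C ->
  dot u (C *m v) ^+ 2 <= dot u (C *m u) * dot v (C *m v).
Proof.
move=> [CT C0].
have Q (k l : R) : 0 <= k ^+ 2 * dot u (C *m u) + 2 * k * l * dot u (C *m v)
    + l ^+ 2 * dot v (C *m v).
  have := C0 (k *: u + l *: v).
  rewrite mulmxDr -!scalemxAr !dotDl !dotDr !dotZl !dotZr (dot_symm C v u CT).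
  by congr (_ <= _); ring.
have a0 := C0 u; have c0 := C0 v.
set a := dot u (C *m u) in Q a0 *; set b := dot u (C *m v) in Q *.
set c := dot v (C *m v) in Q c0 *.
have [ceq|cne] := eqVneq c 0.
  (* For [c = 0] this choice gives the form the value [- b ^+ 2 * (a + 2)], which forces [b = 0]. *)
  have := Q b (- (a + 1)); rewrite ceq mulr0 addr0 => h.
  have : b ^+ 2 * (a + 2) <= 0 by nra.
  by rewrite mulr0 pmulr_lle0//; lra.
have cp : 0 < c by rewrite lt_def cne.
(* At [c *: u - b *: v] the form equals [c * (a * c - b ^+ 2)]. *)
have := Q c (- b); rewrite -subr_ge0 => h.
have : 0 <= c * (a * c - b ^+ 2) by move: h; congr (_ <= _); ring.
by rewrite pmulr_rge0// subr_ge0.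
Qed.

End dot.

(** * Gaussian laws on vectors: second moments and the scalar product [L2dot] *)

Section gaussian.
Context {R : realType} {p : nat}.
Implicit Types (P : probability (borel_cV R p) R) (u v m : 'cV[R]_p).
Implicit Types (C : 'M[R]_p).

Lemma ge0_integral_gaussian P m C u (f : R -> \bar R) :
  is_gaussian P m C -> dot u (C *m u) = 1 ->
  (forall x, (0 <= f x)%E) -> measurable_fun [set: R] f ->
  (\int[P]_x f (dot u x) = \int[normal_prob (dot u m) 1]_t f t)%E.
Proof.
move=> gP q1 f0 mf.
have := ge0_integral_pushforward (measurable_dot p u) P measurableT mf (fun x _ => f0 x).
rewrite preimage_setT => <-.
apply: eq_measure_integral => [|mphi A mA _]; first exact: measurable_dot.
by have := gP u A mA; rewrite /gauss1 q1 sqrtr1 oner_eq0.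
Qed.

Lemma gaussian_degenerate P C u (f : R -> \bar R) :
  is_gaussian P 0 C -> dot u (C *m u) = 0 ->
  (forall x, (0 <= f x)%E) -> measurable_fun [set: R] f ->
  (\int[P]_x f (dot u x) = f 0%R)%E.
Proof.
move=> gP q0 f0 mf.
have := ge0_integral_pushforward (measurable_dot p u) P measurableT mf (fun x _ => f0 x).
rewrite preimage_setT => <-.
transitivity (\int[\d_((0 : R)%R : measurableTypeR R)]_t f t)%E.
  apply: eq_measure_integral => [|mphi A mA _]; first exact: measurable_dot.
  have := gP u A mA; rewrite /gauss1 q0 sqrtr0 eqxx.
  by rewrite [dot u 0]/dot mulmx0 mxE.
by rewrite integral_dirac// diracT mul1e.
Qed.

(** A form of variance [q > 0] is divided by [Num.sqrt q], which leads to the standard normal law; a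
    form of zero variance has the Dirac mass at 0 as its law. *)
Lemma gaussian_second_moment P C u : psd C -> is_gaussian P 0 C ->
  (\int[P]_x ((dot u x ^+ 2)%:E : \bar R) = (dot u (C *m u))%:E)%E.
Proof.
move=> [_ C0] gP.
have f0 (x : R) : (0 <= (x ^+ 2)%:E :> \bar R)%E by rewrite lee_fin sqr_ge0.
have mf : measurable_fun [set: R] (fun x : R => (x ^+ 2)%:E : \bar R).
  by apply/measurable_EFinP; exact: exprn_measurable.
have [q0|q0] := eqVneq (dot u (C *m u)) 0.
  by rewrite (gaussian_degenerate _ _ _ _ gP q0 f0 mf) q0 expr0n.
set q := dot u (C *m u) in q0 *.
have qp : 0 < q by rewrite lt_def q0 C0.
pose s := Num.sqrt q.
have s0 : s != 0 by rewrite gt_eqF// sqrtr_gt0.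
have v1 : dot (s^-1 *: u) (C *m (s^-1 *: u)) = 1.
  rewrite -scalemxAr dotZl dotZr -/q mulrA -expr2 exprVn sqr_sqrtr ?ltW//.
  by rewrite mulVf.
have := ge0_integral_gaussian _ _ _ _ _ gP v1 f0 mf.
have -> : dot (s^-1 *: u) 0 = 0 by rewrite /dot mulmx0 mxE.
rewrite stdnormal_second_moment => h.
transitivity (q%:E * \int[P]_x (dot (s^-1 *: u) x ^+ 2)%:E)%E; last by rewrite h mule1.
rewrite -ge0_integralZl//.
- apply: eq_integral => x _; rewrite dotZl exprMn exprVn sqr_sqrtr ?ltW//.
  by rewrite -EFinM mulrA mulfV// mul1r.
- apply: (measurableT_comp mf); exact: measurable_dot.
- by rewrite lee_fin ltW.
Qed.

Lemma gaussian_integrable_sqr P C u : psd C -> is_gaussian P 0 C ->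
  P.-integrable setT (EFin \o (fun x => dot u x ^+ 2)).
Proof.
move=> pC gP; apply/integrableP; split.
  apply/measurable_EFinP; apply: measurable_funX; exact: measurable_dot.
under eq_integral do rewrite /= ger0_norm ?sqr_ge0//.
by rewrite (gaussian_second_moment _ _ _ pC gP) ltry.
Qed.

(* Polarization reduces the claim to second moments of linear forms. *)
Lemma L2dotE P C u v : psd C -> is_gaussian P 0 C ->
  L2dot P u v = dot u (C *m v).
Proof.
move=> pC gP.
have Rm w : \int[P]_x (dot w x ^+ 2) = dot w (C *m w).
  by rewrite /Rintegral (gaussian_second_moment _ _ _ pC gP).
have ip w := gaussian_integrable_sqr P C w pC gP.
have ipZ w : P.-integrable setT (EFin \o (fun x => 4^-1 * dot w x ^+ 2)).
  have := integrableZl measurableT (4^-1) (ip w).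
  by apply: eq_integrable => // x _ /=; rewrite EFinM.
transitivity (\int[P]_x (4^-1 * dot (u + v) x ^+ 2 - 4^-1 * dot (u - v) x ^+ 2)).
  by apply: eq_Rintegral => x _; rewrite !dotDl dotNl; field.
rewrite (RintegralB measurableT (ipZ (u + v)) (ipZ (u - v))).
rewrite (RintegralZl _ measurableT (ip (u + v))) (RintegralZl _ measurableT (ip (u - v))).
rewrite !Rm mulmxBr mulmxDr !dotDl !dotDr !dotNl !dotNr.
by rewrite (dot_symm C v u (proj1 pC)); field.
Qed.

End gaussian.

(** * Kernel of [C], half-space probabilities and the risk of a linear rule *)

Lemma dot_eq0 {R : realType} (p : nat) (v : 'cV[R]_p) : dot v v = 0 -> v = 0.
Proof.
rewrite /dot mxE => /psumr_eq0P h; apply/colP => i; rewrite mxE.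
have /eqP := h (fun j _ => ltac:(by rewrite mxE -expr2 sqr_ge0)) i isT.
by rewrite mxE mulf_eq0 orbb => /eqP.
Qed.

(** Cauchy-Schwarz for [C *m u] and [u] bounds the fourth power of the Euclidean norm of [C *m u] by
    0. *)
Lemma psd_kernel {R : realType} (p : nat) (C : 'M[R]_p) (u : 'cV[R]_p) :
  psd C -> dot u (C *m u) = 0 -> C *m u = 0.
Proof.
move=> pC q0; apply: dot_eq0; apply/eqP; rewrite -sqrf_eq0.
rewrite eq_le sqr_ge0 andbT.
by have := psd_cauchy_schwarz C (C *m u) u pC; rewrite q0 mulr0.
Qed.

(** Ties go to class 1, so this error set is the preimage of an open half-line under [dot F], and
    the error set of the other class that of a closed one. *)
Lemma gaussian_halfspace {R : realType} (p : nat) (P : probability (borel_cV R p) R)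
    (m F s : 'cV[R]_p) (C : 'M[R]_p) :
  is_gaussian P m C -> 0 < dot F (C *m F) ->
  fine (P [set x | linear_rule F s x != true]) =
  cdfN 0 1 ((dot F s - dot F m) / Num.sqrt (dot F (C *m F))).
Proof.
move=> gP q0; have r0 : 0 < Num.sqrt (dot F (C *m F)) by rewrite sqrtr_gt0.
rewrite -cdfN_shift// -normal_prob_Nyo.
have := gP F `]-oo, dot F s[%classic (measurable_itv _).
rewrite /gauss1 gt_eqF// => <-; congr (fine (P _)).
apply/seteqP; split => x /=; rewrite /linear_rule dotDr dotNr subr_ge0 in_itv/=;
  by case: ltP.
Qed.

Lemma gaussian_halfspaceC {R : realType} (p : nat) (P : probability (borel_cV R p) R)
    (m F s : 'cV[R]_p) (C : 'M[R]_p) :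
  is_gaussian P m C -> 0 < dot F (C *m F) ->
  fine (P [set x | linear_rule F s x != false]) =
  cdfN 0 1 ((dot F m - dot F s) / Num.sqrt (dot F (C *m F))).
Proof.
move=> gP q0; have r0 : 0 < Num.sqrt (dot F (C *m F)) by rewrite sqrtr_gt0.
rewrite -[dot F m - _]opprB mulNr cdfN01N -cdfN_shift// -normal_prob_cy.
have := gP F `[dot F s, +oo[%classic (measurable_itv _).
rewrite /gauss1 gt_eqF// => <-; congr (fine (P _)).
apply/seteqP; split => x /=; rewrite /linear_rule dotDr dotNr subr_ge0 in_itv/= andbT;
  by case: leP.
Qed.

(** Here [a] is half the standardized separation of the means along [F], and [d] the standardized
    offset of [s] from the midpoint, which enters the two class errors with opposite signs. *)
Lemma risk_linear_rule {R : realType} (p : nat) (P0 P1 : probability (borel_cV R p) R)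
    (mu0 mu1 F s : 'cV[R]_p) (C : 'M[R]_p) :
  is_gaussian P0 mu0 C -> is_gaussian P1 mu1 C -> 0 < dot F (C *m F) ->
  let r := Num.sqrt (dot F (C *m F)) in
  let a := 2^-1 * (r^-1 * dot F (mu1 - mu0)) in
  let d := r^-1 * dot F (s - 2^-1 *: (mu1 + mu0)) in
  risk P0 P1 (linear_rule F s) =
  2^-1 * (cdfN 0 1 (- a + d) + cdfN 0 1 (- a - d)).
Proof.
move=> g0 g1 q0 r a d; rewrite /risk.
rewrite (gaussian_halfspace _ _ _ _ _ _ g1 q0) (gaussian_halfspaceC _ _ _ _ _ _ g0 q0) -/r.
have r0 : r != 0 by rewrite gt_eqF// sqrtr_gt0.
congr (_ * (cdfN 0 1 _ + cdfN 0 1 _)).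
  by rewrite /a /d !dotDr !dotNr dotZr dotDr; field.
by rewrite /a /d !dotDr !dotNr dotZr dotDr; field.
Qed.

(** * Probabilities of intervals and the bounds on the excess risk *)

Lemma stdnormal_oc {R : realType} (b : R) : 0 <= b ->
  stdnormal [set t | 0 < t <= b] = cdfN 0 1 b - 2^-1.
Proof.
by move=> b0; rewrite -cdfN0 -normal_prob_oc//; congr (fine (normal_prob 0 1 _)).
Qed.

Lemma stdnormal_norm_ge {R : realType} (b : R) : 0 <= b ->
  cdfN 0 1 b - cdfN 0 1 (- b) <= stdnormal [set t | `|t| <= b].
Proof.
move=> b0; rewrite -normal_prob_oc ?ge0_cp//.
have -> : [set t : R | `|t| <= b] = `[- b, b]%classic.
  by apply/seteqP; split => t /=; rewrite in_itv/= ler_norml.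
rewrite /stdnormal fine_le ?fin_num_measure//.
apply: le_measure; rewrite ?inE//; exact: subset_itv_oc_cc.
Qed.

Theorem theorem5p1 (R : realType) :
  exists2 c : R, 0 < c &
  forall (p : nat) (C Cm : 'M[R]_p) (mu0 mu1 Fhat shat : 'cV[R]_p)
    (P0 P1 PC : probability (borel_cV R p) R),
  psd C ->
  is_moore_penrose C Cm ->
  is_gaussian P0 mu0 C ->
  is_gaussian P1 mu1 C ->
  is_gaussian PC 0 C ->
  (exists h : 'cV[R]_p, C *m h = mu1 - mu0) ->
  let F10 := Cm *m (mu1 - mu0) in
  let s10 := 2^-1 *: (mu1 + mu0) in
  F10 != 0 ->
  L2norm PC Fhat != 0 ->
  let Cstar := risk P0 P1 (linear_rule F10 s10) in
  let Cg := risk P0 P1 (linear_rule Fhat shat) in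
  let d0 := (L2norm PC Fhat)^-1 * dot Fhat (shat - s10) in
  let alpha := L2angle PC Fhat F10 in
  2^-1 * stdnormal [set t | 0 < t <= L2norm PC F10 * ((1 - cos alpha) / 2)]
    * expR (- (L2norm PC F10 ^+ 2 / 8)) <= Cg - Cstar /\
  Cg - Cstar <=
    c * stdnormal [set t | `|t| <= (1 - cos alpha) * L2norm PC F10]
    + c * d0 ^+ 2.
Proof.
exists 1 => // p C Cm mu0 mu1 Fhat shat P0 P1 PC pC [CCmC _ _ _] g0 g1 gC [h Ch].
move=> F10 s10 F10n0 Fhatn0 Cstar Cg d0 alpha.
(* Scalar products with [mu1 - mu0] thereby become [L2dot] products with [F10]. *)
have CF10 : C *m F10 = mu1 - mu0 by rewrite /F10 -Ch !mulmxA CCmC.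
have L2 u v : L2dot PC u v = dot u (C *m v) by exact: L2dotE.
(* If the form vanished at [F10], then [mu1 - mu0 = C *m F10] would be 0, and with it [F10]. *)
have qF10 : 0 < dot F10 (C *m F10).
  rewrite lt_def (proj2 pC) andbT; apply: contra F10n0 => /eqP q0.
  by rewrite /F10 -CF10 (psd_kernel _ _ _ pC q0) mulmx0.
have qFhat : 0 < dot Fhat (C *m Fhat).
  rewrite lt_def (proj2 pC) andbT; apply: contra Fhatn0 => /eqP q0.
  by rewrite /L2norm L2 q0 sqrtr0.
have s2 : L2norm PC F10 ^+ 2 = dot F10 (C *m F10).
  by rewrite sqr_sqrtr L2// ltW.
have n2 : L2norm PC Fhat ^+ 2 = dot Fhat (C *m Fhat).
  by rewrite sqr_sqrtr L2// ltW.
have sgt0 : 0 < L2norm PC F10 by rewrite /L2norm L2 sqrtr_gt0.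
have ngt0 : 0 < L2norm PC Fhat by rewrite /L2norm L2 sqrtr_gt0.
set sg := L2norm PC F10 in s2 sgt0 *.
set n := L2norm PC Fhat in d0 n2 ngt0 *.
(* The argument of [acos] in [alpha]; Cauchy-Schwarz places it in [[-1, 1]], where [cos] undoes
   [acos]. *)
pose k := dot Fhat (C *m F10) / (n * sg).
have k1 : -1 <= k <= 1.
  rewrite -ler_norml -(@ler_pXn2r _ 2)// ?nnegrE// expr1n real_normK ?num_real//.
  rewrite /k exprMn exprVn ler_pdivrMr ?exprn_gt0 ?mulr_gt0// mul1r exprMn s2 n2.
  exact: psd_cauchy_schwarz.
have cosE : cos alpha = k by rewrite /alpha /L2angle acosK// L2.
have ECg : Cg = 2^-1 * (cdfN 0 1 (- (sg / 2 * k) + d0) + cdfN 0 1 (- (sg / 2 * k) - d0)).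
  rewrite /Cg (risk_linear_rule _ _ _ _ _ _ _ _ g0 g1 qFhat).
  have -> : Num.sqrt (dot Fhat (C *m Fhat)) = n by rewrite /n /L2norm L2.
  rewrite -/s10 -/d0; suff -> : 2^-1 * (n^-1 * dot Fhat (mu1 - mu0)) = sg / 2 * k by [].
  by rewrite -CF10 /k; field; rewrite !gt_eqF.
(* The offset is 0 and [a = b = sg / 2], so the two class errors coincide. *)
have ECs : Cstar = cdfN 0 1 (- (sg / 2)).
  rewrite /Cstar (risk_linear_rule _ _ _ _ _ _ _ _ g0 g1 qF10).
  have -> : Num.sqrt (dot F10 (C *m F10)) = sg by rewrite /sg /L2norm L2.
  rewrite -/s10 subrr [dot F10 0]/dot mulmx0 mxE mulr0 addr0 subr0.
  rewrite -CF10 -s2.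
  have -> : 2^-1 * (sg^-1 * sg ^+ 2) = sg / 2 by field; rewrite gt_eqF.
  by field.
have [kN1 k1'] := andP k1.
have ba : - (sg / 2) <= sg / 2 * k by nra.
have ab : sg / 2 * k <= sg / 2 by nra.
rewrite cosE; split.
  rewrite stdnormal_oc; last by rewrite mulr_ge0 ?(ltW sgt0)// divr_ge0// subr_ge0.
  have := excess_lower _ _ d0 ba ab; rewrite -ECg -ECs.
  have -> : sg / 2 - sg / 2 * k = sg * ((1 - k) / 2) by field.
  by have -> : (sg / 2) ^+ 2 / 2 = sg ^+ 2 / 8 by field.
rewrite !mul1r; have := excess_upper _ _ d0 ba ab; rewrite -ECg -ECs.
have -> : 2 * (sg / 2 - sg / 2 * k) = (1 - k) * sg by field.
move=> /le_trans; apply; rewrite lerD2r stdnormal_norm_ge//.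
by rewrite mulr_ge0 ?(ltW sgt0)// subr_ge0.
Qed.
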